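(* Let $E$ be a Banach space, let $n \ge 1$, and let $A = (A_1, A_2, \ldots, A_n)$ and $B = (B_1, B_2, \ldots, B_n)$ be $n$-tuples of operators in $B(E)$, each of which is a commuting family, i.e. $A_iA_j = A_jA_i$ and $B_iB_j = B_jB_i$ for all $1 \le i, j \le n$. Let $R_{A,B} : B(E) \to B(E)$ be the elementary operator defined by $$R_{A,B}(X) = A_1XB_1 + A_2XB_2 + \cdots + A_nXB_n \quad \text{for all } X \in B(E).$$ If for each $1 \le i \le n$ either $A_i$ or $B_i$ is nilpotent, then $R_{A,B}$ is nilpotent.
   Context: For a Banach space $E$ (over $\mathbb{R}$ or $\mathbb{C}$), $B(E)$ denotes the algebra of all bounded linear operators on $E$. An operator $T$ (on $E$, or on $B(E)$) is nilpotent if $T^k = 0$ for some positive integer $k$; for an operator on $B(E)$, powers are taken with respect to composition. ''Either ... or'' is inclusive, and which of $A_i$, $B_i$ is nilpotent may depend on $i$. *)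

(* Defs.v *)
From HB Require Import structures.
From mathcomp Require Import all_boot all_order all_algebra.
From mathcomp Require Import boolp classical_sets functions reals topology.
From mathcomp Require Import normedtype.
From mathcomp Require Import complex.
Set Implicit Arguments.
Unset Strict Implicit.
Unset Printing Implicit Defensive.
Import Order.TTheory GRing.Theory Num.Theory.
Import numFieldTopology.Exports numFieldNormedType.Exports.
Local Open Scope ring_scope.

Inductive scalar_kind := RealScalars | ComplexScalars.

Definition scalar_field (R : realType) (k : scalar_kind) : numFieldType :=
  match k with
  | RealScalars => R
  | ComplexScalars => R[i]
  end.

Section BoundedOp.
Context (K : numFieldType) (E : normedModType K).

(* For complex scalars, [`|x|] is a nonnegative real element of [R[i]], and
   the partial order of [R[i]] forces the bound M to be real unless E = 0. *)
Definition is_bounded_op (f : E -> E) : Prop :=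
  linear f /\ exists M : K, forall x, `|f x| <= M * `|x|.

Definition bounded_op_pred : {pred E -> E} := fun f => `[< is_bounded_op f >].

Record bounded_op := BoundedOp {
  bounded_op_fun :> E -> E;
  bounded_op_funP : bounded_op_fun \in bounded_op_pred }.

HB.instance Definition _ := [isSub for bounded_op_fun].
HB.instance Definition _ := [Choice of bounded_op by <:].

Lemma bounded_opP (f : bounded_op) : is_bounded_op f.
Proof. exact/asboolP/(bounded_op_funP f). Qed.

Fact bounded_op_zmod_closed : zmod_closed bounded_op_pred.
Proof.
split=> [|f g /asboolP[lf [M hM]] /asboolP[lg [N hN]]]; apply/asboolP; split.
- by move=> a x y; rewrite scaler0 addr0.
- by exists 0 => x; rewrite normr0 mul0r.
- move=> a x y; change (f (a *: x + y) - g (a *: x + y) =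
                        a *: (f x - g x) + (f y - g y)).
  by rewrite lf lg scalerBr opprD addrACA.
- exists (M + N) => x; rewrite mulrDl.
  exact: le_trans (ler_normB _ _) (lerD (hM x) (hN x)).
Qed.

HB.instance Definition _ :=
  GRing.isZmodClosed.Build (E -> E) bounded_op_pred bounded_op_zmod_closed.
HB.instance Definition _ := [SubChoice_isSubZmodule of bounded_op by <:].

Fact bounded_op_one_subproof : id \in bounded_op_pred.
Proof. by apply/asboolP; split=> //; exists 1 => x; rewrite mul1r. Qed.

Definition bounded_op_one := BoundedOp bounded_op_one_subproof.

Fact bounded_op_mul_subproof (f g : bounded_op) : f \o g \in bounded_op_pred.
Proof.
have [lf [M hM]] := bounded_opP f; have [lg [N hN]] := bounded_opP g.
apply/asboolP; split=> [a x y /=|]; first by rewrite lg lf.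
exists (`|M| * N) => x /=.
apply: (le_trans (hM _)); have := hM (g x).
have [->|gx0] := eqVneq (g x) 0.
  by rewrite normr0 mulr0 -mulrA => _; rewrite mulr_ge0 // (le_trans _ (hN x)).
move=> hgx; have M0 : 0 <= M.
  by rewrite -(pmulr_lge0 (x := `|g x|)) ?normr_gt0 // (le_trans _ hgx).
by rewrite ger0_norm // -mulrA ler_wpM2l.
Qed.

Definition bounded_op_mul (f g : bounded_op) :=
  BoundedOp (bounded_op_mul_subproof f g).

Fact bounded_op_mulA : associative bounded_op_mul.
Proof. by move=> f g h; exact: val_inj. Qed.

Fact bounded_op_mul1l : left_id bounded_op_one bounded_op_mul.
Proof. by move=> f; exact: val_inj. Qed.

Fact bounded_op_mul1r : right_id bounded_op_one bounded_op_mul.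
Proof. by move=> f; exact: val_inj. Qed.

Fact bounded_op_mulDl : left_distributive bounded_op_mul +%R.
Proof. by move=> f g h; exact: val_inj. Qed.

Fact bounded_op_mulDr : right_distributive bounded_op_mul +%R.
Proof.
move=> f g h; apply: val_inj; apply/funext => x.
have [lf _] := bounded_opP f.
by have := lf 1 (g x) (h x); rewrite !scale1r.
Qed.

(* Only a [pzRingType]: if E is the zero space then 1 = 0 in B(E). *)
HB.instance Definition _ := GRing.Zmodule_isPzRing.Build bounded_op
  bounded_op_mulA bounded_op_mul1l bounded_op_mul1r
  bounded_op_mulDl bounded_op_mulDr.

Lemma bounded_op_addE (f g : bounded_op) x : (f + g) x = f x + g x.
Proof. by []. Qed.

Lemma bounded_op_mulE (f g : bounded_op) x : (f * g) x = f (g x).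
Proof. by []. Qed.

End BoundedOp.

(* Used both for operators on E (through the coercion of [bounded_op E] to
   functions) and for operators on B(E); powers are iterated compositions. *)
Definition nilpotent_op (V : nmodType) (T : V -> V) : Prop :=
  exists2 k : nat, (0 < k)%N & forall v, iter k T v = 0.

Definition elementary_op (K : numFieldType) (E : normedModType K) (n : nat)
    (A B : 'I_n -> bounded_op E) (X : bounded_op E) : bounded_op E :=
  \sum_(i < n) A i * X * B i.

(* Main.v *)
From HB Require Import structures.
Require Import Defs.
From mathcomp Require Import all_boot all_order all_algebra.
From mathcomp Require Import reals normedtype.
Import GRing.Theory.
Local Open Scope ring_scope.

(** The maps [X |-> A i * X * B i] commute pairwise and each of them is
    nilpotent, so it suffices that a finite sum of commuting nilpotent additive
    maps is nilpotent.  If [iter (d i) (T i) v = 0] for all [i], then [T j v]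
    satisfies the same with [d j] lowered by one, so each application of
    [\sum_i T i] lowers [\sum_i d i] on every summand, until some [d i] is [0],
    i.e. the vector itself is [0]. *)

Lemma iter_comm {X : Type} (f g : X -> X) (m : nat) (x : X) :
  (forall y, f (g y) = g (f y)) -> iter m f (g x) = g (iter m f x).
Proof. by move=> fg; elim: m => //= m ->. Qed.

Lemma iter_raddf_sum {V : nmodType} (f : {additive V -> V}) (I : finType)
    (m : nat) (F : I -> V) :
  iter m f (\sum_i F i) = \sum_i iter m f (F i).
Proof. by elim: m => //= m ->; rewrite raddf_sum. Qed.

Lemma iter_raddf0 {V : nmodType} (f : {additive V -> V}) (m : nat) :
  iter m f 0 = 0.
Proof. by elim: m => //= m ->; rewrite raddf0. Qed.

(* The exponent has a successor because an empty sum of maps kills [v] only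
   after one application. *)
Lemma iter_sum_comm_eq0 {V : nmodType} (I : finType)
    (T : I -> {additive V -> V}) (S : {additive V -> V}) (d : I -> nat) (v : V) :
  (forall x, S x = \sum_i T i x) ->
  (forall i j x, T i (T j x) = T j (T i x)) ->
  (forall i, iter (d i) (T i) v = 0) ->
  iter (\sum_i d i).+1 S v = 0.
Proof.
(* The induction is on the value of the sum, with [d] and [v] kept general: the inductive call
   lowers [d] and replaces [v] by [T i v]. *)
move=> SE TC; move: {2}(\sum_i d i)%N (erefl (\sum_i d i)%N) => m.
elim: m d v => [|m IHm] d v dm Tv0; rewrite dm iterSr SE.
  apply: big1 => i _; move/eqP: dm; rewrite sum_nat_eq0 => /forall_inP/(_ i isT)/eqP di0.
  by have := Tv0 i; rewrite di0 /= => ->; rewrite raddf0.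
rewrite iter_raddf_sum; apply: big1 => i _.
(* If [d i = 0] there is nothing to lower, but then [v] itself is [0]. *)
case di: (d i) => [|p].
  have -> : v = 0 by have := Tv0 i; rewrite di.
  by rewrite raddf0 iter_raddf0.
pose d' j := if j == i then p else d j.
have d'm : (\sum_j d' j)%N = m.
  apply: succn_inj; rewrite -dm (bigD1 i) // [RHS](bigD1 i) //= /d' eqxx di addSn.
  by congr (_ + _).+1; apply: eq_bigr => j /negPf ->.
(* For [j = i], the missing iteration is the [T i] already applied to [v]; for the other [j], that
   [T i] commutes out of the iterates of [T j], which kill [v]. *)
rewrite -d'm; apply: IHm => // j; rewrite /d'; case: eqP => [->|_].
  by rewrite -iterSr -di.
by rewrite iter_comm ?Tv0 ?raddf0 // => x; exact: TC.
Qed.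

(** Each exponent [d i] serves every vector at once, so the exponent obtained for the sum is uniform
    in [v]. *)
Lemma nilpotent_op_sum_comm {V : nmodType} (I : finType)
    (T : I -> {additive V -> V}) (S : {additive V -> V}) :
  (forall x, S x = \sum_i T i x) ->
  (forall i j x, T i (T j x) = T j (T i x)) ->
  (forall i, nilpotent_op (T i)) -> nilpotent_op S.
Proof.
move=> SE TC Tnil.
have /fin_all_exists[d dP] i : exists m, forall x, iter m (T i) x = 0.
  by have [m _ mP] := Tnil i; exists m.
by exists (\sum_i d i).+1 => // v; apply: (@iter_sum_comm_eq0 _ _ T) => // i.
Qed.

Lemma bounded_op_expE {K : numFieldType} {E : normedModType K}
    (f : bounded_op E) (m : nat) (x : E) : (f ^+ m) x = iter m f x.
Proof. by elim: m => // m IHm; rewrite exprS bounded_op_mulE IHm. Qed.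

(** Turns pointwise iterates on [E] into powers in the ring B(E), the form usable inside a product
    with [X]. *)
Lemma nilpotent_op_exp {K : numFieldType} {E : normedModType K}
    (f : bounded_op E) :
  nilpotent_op f -> exists2 m : nat, (0 < m)%N & f ^+ m = 0.
Proof.
case=> m m0 fm; exists m => //; apply: val_inj; apply: boolp.funext => x.
by rewrite /= bounded_op_expE fm.
Qed.

(** Named so that an additive structure can be attached to it, as the lemma on commuting sums
    requires. *)
Definition mul_lr {S : pzRingType} (a b x : S) : S := a * x * b.

Lemma iter_mul_lr {S : pzRingType} (a b x : S) (m : nat) :
  iter m (mul_lr a b) x = a ^+ m * x * b ^+ m.
Proof.
elim: m => [|m IHm] /=; first by rewrite !expr0 mul1r mulr1.
by rewrite IHm /mul_lr exprS exprSr !mulrA.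
Qed.

Lemma nilpotent_op_mul_lr {K : numFieldType} {E : normedModType K}
    (a b : bounded_op E) :
  nilpotent_op a \/ nilpotent_op b -> nilpotent_op (mul_lr a b).
Proof.
by case=> /nilpotent_op_exp[m m0 cm0]; exists m => // X;
  rewrite iter_mul_lr cm0 ?mulr0 ?mul0r.
Qed.

Fact mul_lr_is_zmod_morphism {S : pzRingType} (a b : S) :
  zmod_morphism (mul_lr a b).
Proof. by move=> x y; rewrite /mul_lr mulrBr mulrBl. Qed.

HB.instance Definition _ (S : pzRingType) (a b : S) :=
  GRing.isZmodMorphism.Build S S (mul_lr a b) (mul_lr_is_zmod_morphism a b).

Fact elementary_op_is_zmod_morphism (K : numFieldType) (E : normedModType K)
    (n : nat) (A B : 'I_n -> bounded_op E) : zmod_morphism (elementary_op A B).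
Proof.
move=> X Y; rewrite /elementary_op -sumrB; apply: eq_bigr => i _.
by rewrite mulrBr mulrBl.
Qed.

HB.instance Definition _ (K : numFieldType) (E : normedModType K)
    (n : nat) (A B : 'I_n -> bounded_op E) :=
  GRing.isZmodMorphism.Build (bounded_op E) (bounded_op E) (elementary_op A B)
    (elementary_op_is_zmod_morphism K E n A B).

Theorem theorem2p2 (R : realType) (k : scalar_kind)
    (E : completeNormedModType (scalar_field R k)) (n : nat) (hn : (1 <= n)%N)
    (A B : 'I_n -> bounded_op E)
    (hA : forall i j : 'I_n, A i * A j = A j * A i)
    (hB : forall i j : 'I_n, B i * B j = B j * B i)
    (hnil : forall i : 'I_n, nilpotent_op (A i) \/ nilpotent_op (B i)) :
  nilpotent_op (elementary_op A B).
Proof.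
apply: (@nilpotent_op_sum_comm _ _ (fun i => mul_lr (A i) (B i))).
- by [].
(* Left factors are swapped by [hA] and right factors by [hB], on either side of [X]. *)
- by move=> i j X; rewrite /= /mul_lr !mulrA hA -!mulrA hB.
- by move=> i; exact: nilpotent_op_mul_lr.
Qed.
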